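(* Let $E:\mathcal{H}\to\mathbb{R}$ be of class $C^2$ and let $R:\mathcal{H}\to\mathcal{H}$ be a retraction of class $C^2$ such that for all $P\in\mathcal{M}_N$ and all $X\in\mathcal{H}$ small enough, $R(P+X)\in\mathcal{M}_N$ and $R(P+X)=P+\Pi_P(X)+O(X^2)$. Then there exists $\beta_0>0$ such that for all $0<\beta\le\beta_0$ and all $P^0\in\mathcal{M}_N$, the iterates \[ P^{k+1}:=R\big(P^k-\beta\,\Pi_{P^k}(\nabla E(P^k))\big) \] satisfy: (1) $(E(P^k))_{k\in\mathbb{N}}$ is a nonincreasing sequence converging to some critical value $E_{\rm c}$ of $E$ on $\mathcal{M}_N$; (2) as $k\to\infty$, $\Pi_{P^k}\nabla E(P^k)\to 0$, $\|P^{k+1}-P^k\|_{\rm F}\to 0$, and $d(P^k,A_{\rm c})\to0$, where $A_{\rm c}$ is one of the connected components of $C(E_{\rm c}):=\{P\in\mathcal{M}_N\mid E(P)=E_{\rm c}\text{ and }\Pi_P(\nabla E(P))=0\}$.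
   Context: $\mathcal{H}$ denotes the space of real symmetric $N_b\times N_b$ matrices with the Frobenius inner product $\langle A,B\rangle_{\rm F}=\mathrm{Tr}(AB)$ and norm $\|\cdot\|_{\rm F}$; $d$ is the associated distance. For an integer $1\le N\le N_b$, $\mathcal{M}_N:=\{P\in\mathcal{H}\mid P^2=P,\ \mathrm{Tr}(P)=N\}$ (rank-$N$ orthogonal projectors). For $P\in\mathcal{M}_N$, $\Pi_P:\mathcal{H}\to\mathcal{H}$, $\Pi_P(X)=PX(1-P)+(1-P)XP$, is the Frobenius-orthogonal projection onto the tangent space $T_P\mathcal{M}_N=\{X\in\mathcal{H}\mid PXP=(1-P)X(1-P)=0\}$. $\nabla E$ is the Frobenius gradient of $E$. A critical point of $E$ on $\mathcal{M}_N$ is a $P\in\mathcal{M}_N$ with $\Pi_P(\nabla E(P))=0$, and a critical value is the value of $E$ at a critical point. *)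

(* Defs.v *)
From HB Require Import structures.
From mathcomp Require Import all_boot all_order all_algebra.
From mathcomp Require Import all_classical all_reals all_analysis.
Set Implicit Arguments. Unset Strict Implicit. Unset Printing Implicit Defensive.
Import Order.TTheory GRing.Theory Num.Theory.
Import numFieldNormedType.Exports.
Local Open Scope classical_set_scope.
Local Open Scope ring_scope.

Section Defs.
Variables (R : realType) (n : nat).
Local Notation M := 'M[R]_n.

Definition symmx (A : M) : Prop := A^T = A.
Definition Hset : set M := [set A | symmx A].

Definition frob_ip (A B : M) : R := \tr (A *m B).
Definition frob (A : M) : R := Num.sqrt (\tr (A^T *m A)).

Definition dist_set (P : M) (A : set M) : R := inf [set frob (P - Q) | Q in A].

(* M_N : rank-N orthogonal projectors *)
Definition MN (N : nat) : set M :=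
  [set P | symmx P /\ P *m P = P /\ \tr P = N%:R].

Definition PiP (P X : M) : M :=
  P *m X *m (1%:M - P) + (1%:M - P) *m X *m P.


(* f : H -> W is of class C^2 on H (as a function on the finite-dimensional
   space H): all first and second directional derivatives along directions of
   H exist at every point of H and are continuous on H. *)
Definition C2_on_H (W : normedModType R) (f : M -> W) : Prop :=
  forall V U : M, symmx V -> symmx U ->
    (forall P, symmx P -> derivable f P V) /\
    {within Hset, continuous ('D_V f : M -> W)} /\
    (forall P, symmx P -> derivable ('D_V f : M -> W) P U) /\
    {within Hset, continuous (('D_U ('D_V f)) : M -> W)}.

Definition is_frob_gradient (E : M -> R) (G : M -> M) : Prop :=
  forall P, symmx P ->
    symmx (G P) /\ forall X, symmx X -> ('D_X E P) = frob_ip (G P) X.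

Definition critical_point (N : nat) (G : M -> M) (P : M) : Prop :=
  MN N P /\ PiP P (G P) = 0.
Definition critical_value (N : nat) (E : M -> R) (G : M -> M) (c : R) : Prop :=
  exists P, critical_point N G P /\ E P = c.
Definition crit_set (N : nat) (E : M -> R) (G : M -> M) (c : R) : set M :=
  [set P | critical_point N G P /\ E P = c].

End Defs.

(* Main.v *)
(* Write T_P = Pi_P(grad E(P)).  If P and Y both lie on M_N, the component of Y - P normal to the
   tangent space at P is quadratic in Y - P, so in <grad E(P), Y - P> the retraction error only
   enters through <T_P, .>, where an error small relative to the step suffices.  Such an error
   bound holds locally uniformly in P because R is C^1 with derivative Pi_P at P, and together
   with the local Lipschitz continuity of grad E it gives E(P^{k+1}) <= E(P^k) - beta/2 |T_k|^2
   near each point of M_N for small beta; compactness of M_N makes beta uniform.  Hence T_k and the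
   steps P^{k+1} - P^k tend to 0, and the omega-limit set, which is connected since the steps
   vanish, consists of critical points of one value and lies in a single component.

   Norm bars denote the entrywise maximum norm, the one carrying the topology of 'M[R]_n; comparing it
   with the Frobenius norm and with products produces the powers of n in the constants. *)
Require Import Defs.
From HB Require Import structures.
From mathcomp Require Import all_boot all_order all_algebra.
From mathcomp Require Import all_classical all_reals all_analysis.
From mathcomp Require Import ring lra.
Import Order.TTheory GRing.Theory Num.Theory.
Import numFieldNormedType.Exports.
Local Open Scope classical_set_scope.
Local Open Scope ring_scope.

(** * Compactness and omega-limit sets of sequences *)

(** Turns a local bound into a uniform one: [r] is both the size of the neighbourhood and the
    parameter of [Q]. Covering compactness along the filter of small positive [r] replaces the
    minimum over a finite subcover, and monotonicity in [r] allows the shrinking. *)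
Lemma compact_uniform_radius (R : realType) (V : normedModType R) (K : set V)
    (Q : V -> R -> Prop) :
  compact K -> (forall y r s, s <= r -> Q y r -> Q y s) ->
  (forall x, K x -> exists2 r, 0 < r & forall y, K y -> `|x - y| < r -> Q y r) ->
  exists2 r, 0 < r & forall y, K y -> Q y r.
Proof.
move=> /compact_near_coveringP/near_covering_withinP cK Qmono locQ.
have KQ : \forall r \near 0^'+, K `<=` Q^~ r; last first.
  by have [r [Kr r0]] := @filter_ex _ (0 : R)^'+ _ _ (filterI KQ (nbhs_right_gt (0 : R))); exists r.
apply: (cK _ (0^'+) (fun r y => Q y r)) => x Kx.
have [r r0 xQ] := locQ x Kx.
exists (ball x r, [set s | s < r]) => /=.
  split; first exact: nbhsx_ballx.
  exact: nbhs_right_lt.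
move=> [y s] /= [xy sr] Ky; apply: (Qmono _ _ _ (ltW sr)); apply: xQ => //.
by move: xy; rewrite -ball_normE.
Qed.

Section omega_limit.
Context {R : realType} {V : normedModType R}.
Variables (K : set V) (u : nat -> V).
Hypotheses (cK : compact K) (uK : forall k, K (u k)).
Let A := cluster (u @ \oo).

Lemma omega_limitP a : A a <->
  forall e, 0 < e -> forall m, exists2 k, (m <= k)%N & `|a - u k| < e.
Proof.
split=> [Aa e e0 m|H B C [m _ mB] /nbhs_ballP[e /= e0 eC]].
- have [|_ [[k /= mk <-] ak]] := Aa (u @` [set k | (m <= k)%N]) _ _ (nbhsx_ballx a e e0).
    by exists m => // k mk; exists k.
  by exists k => //; move: ak; rewrite -ball_normE.
- have [k mk ak] := H _ e0 m; exists (u k); split; first exact: mB.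
  by apply: eC; rewrite -ball_normE.
Qed.

Lemma omega_limit_nonempty : A !=set0.
Proof.
have [a [_ Aa]] := cK (u @ \oo) _ (filterS (fun k _ => uK k) (filterT : \oo setT)).
by exists a.
Qed.

Lemma omega_limit_closed : closed A.
Proof. by rewrite /A clusterE; apply: closed_bigI => B _; exact: closed_closure. Qed.

Lemma omega_limit_sub : closed K -> A `<=` K.
Proof.
move=> clK a; rewrite /A clusterE => /(_ K) aK; apply: clK; apply: aK.
by exists 0 => // k _; exact: uK.
Qed.

(** Otherwise the tail filter restricted to the complement of [U] is proper, and compactness gives
    it a cluster point. That point is an omega-limit point, hence in [U], yet the open set [U] would
    have to meet its own complement. *)
Lemma omega_limit_near (U : set V) :
  open U -> A `<=` U -> \forall k \near \oo, U (u k).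
Proof.
move=> oU AU; apply: contrapT => nU.
have PF : ProperFilter (within (~` U) (u @ \oo)).
  split; last exact: within_filter.
  move=> UF; apply: nU; move: UF; rewrite /within/=.
  by apply: filterS => k /=; apply: contrapT.
have [|a [_ aU]] := cK (within (~` U) (u @ \oo)) PF.
  by exists 0 => // k _ _; exact: uK.
have : A a.
  move=> B C FB aC; apply: aU => //.
  by apply: filterS FB => x Bx _.
move=> /AU Ua.
have [|x [nUx /nUx]//] := aU (~` U) U _ (open_nbhs_nbhs (conj oU Ua)).
exact: withinT.
Qed.

Lemma omega_limit_approx (e : R) : 0 < e ->
  \forall k \near \oo, exists2 a, A a & `|a - u k| < e.
Proof.
move=> e0.
have : \forall k \near \oo, (\bigcup_(a in A) ball a e) (u k).
  apply: omega_limit_near => [|a Aa]; last by exists a => //; exact: ballxx.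
  by apply: bigcup_open => a _; exact: ball_open.
by apply: filterS => k [a Aa]; rewrite -ball_normE => ?; exists a.
Qed.

(** A nonempty relatively clopen part [B] of the compact set [A] has a distance [d] from the rest of
    [A]. Once steps are shorter than [d / 3] and the tail is [d / 3]-close to [A], closeness to [B]
    passes from each term to the next. Every point of [A] is approached arbitrarily late, so it lies
    in [B]. *)
Lemma omega_limit_connected :
  (fun k => u k.+1 - u k) @ \oo --> (0 : V) -> closed K -> connected A.
Proof.
move=> du clK B [b Bb] [C oC BC] [D cD BD].
have cA : compact A by apply: subclosed_compact omega_limit_closed cK (omega_limit_sub clK).
have [d d0 sepB] : exists2 d, 0 < d &
    forall y, A y -> B y -> forall z, A z -> `|y - z| < d -> B z.
  apply: compact_uniform_radius => // [y r s sr + By z Az yz|x Ax].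
    by apply=> //; exact: lt_le_trans sr.
  (* Near a point of [B] the open set [C] forces [z] into [B]; near any other point of [A] the
     complement of the closed set [D] excludes [y] from [B]. *)
  have [Bx|nBx] := pselect (B x).
    have : nbhs x C by apply: open_nbhs_nbhs; split => //; move: Bx; rewrite BC => -[].
    move=> /nbhs_ballP[r /= r0 xC]; exists (r / 2); first by rewrite divr_gt0.
    move=> y Ay xy By z Az yz; rewrite BC; split=> //; apply: xC.
    rewrite -ball_normE /= -(subrKA y) (splitr r).
    by rewrite (le_lt_trans (ler_normD _ _))// ltrD.
  have : nbhs x (~` D).
    apply: open_nbhs_nbhs; split => //; first exact: closed_openC.
    by move=> Dx; apply: nBx; rewrite BD.
  move=> /nbhs_ballP[r /= r0 xC]; exists r => // y Ay xy.
  by rewrite BD => -[_ Dy]; exfalso; apply: (xC y) => //; rewrite -ball_normE.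
apply/seteqP; split=> [x|c Ac]; first by rewrite BC => -[].
have Ab : A b by move: Bb; rewrite BC => -[].
have d3 : 0 < d / 3 by rewrite divr_gt0.
have tri3 (x y z w : V) : `|x - y| < d / 3 -> `|y - z| < d / 3 -> `|z - w| < d / 3 -> `|x - w| < d.
  by move=> xy yz zw; have := ler_distD y x w; have := ler_distD z y w; lra.
have du3 : \forall k \near \oo, `|u k.+1 - u k| < d / 3.
  by move/cvgr0Pnorm_lt : du; apply.
have [m _ mP] := filterI (omega_limit_approx _ d3) du3.
have [k0 mk0 bk0] := (omega_limitP b).1 Ab _ d3 m.
have stay j : exists2 a, B a & `|a - u (k0 + j)%N| < d / 3.
  elim: j => [|j [a Ba aj]]; first by exists b => //; rewrite addn0.
  have [|[a' Aa' a'j] _] := mP (k0 + j.+1)%N.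
    by rewrite /= (leq_trans mk0)// leq_addr.
  have [|_ step] := mP (k0 + j)%N.
    by rewrite /= (leq_trans mk0)// leq_addr.
  (* From [a] to [a'] by three short links, through two consecutive terms of the sequence. *)
  exists a' => //; apply: (sepB a) => //; first by move: Ba; rewrite BC => -[].
  apply: (tri3 _ (u (k0 + j)%N) (u (k0 + j.+1)%N)) => //.
    by rewrite distrC addnS.
  by rewrite distrC.
have [k k0k ck] := (omega_limitP c).1 Ac _ d3 k0.
have [a Ba] := stay (k - k0)%N; rewrite subnKC// => ak.
apply: (sepB a) => //; first by move: Ba; rewrite BC => -[].
apply: (tri3 _ (u k) (u k)) => //; first by rewrite subrr normr0.
by rewrite distrC.
Qed.

End omega_limit.

(** * Mean value inequalities from directional derivatives *)

Section directional_mean_value.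
Context {R : realType} {V : normedModType R}.

Lemma is_derive_line (f : V -> R) (P S : V) (t : R) :
  derivable f (P + t *: S) S ->
  is_derive t (1 : R) (fun s : R => f (P + s *: S)) ('D_S f (P + t *: S)).
Proof.
have E : (fun h => h^-1 *: ((f \o shift (P + t *: S)) (h *: S) - f (P + t *: S))) =
    (fun h => h^-1 *: (((fun s : R => f (P + s *: S)) \o shift t) (h *: (1 : R)) - f (P + t *: S))).
  by apply/funext => h /=; rewrite -[h *: 1]/(h * 1) mulr1 scalerDl addrCA.
by move=> df; apply: DeriveDef; rewrite /derive /derivable -E.
Qed.

Lemma line_mean_value (f : V -> R) (P S : V) (x c e : R) :
  (forall t, derivable f (P + t *: S) S) ->
  (forall t, `|t| <= `|x| -> `|'D_S f (P + t *: S) - c| <= e) ->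
  `|f (P + x *: S) - f P - x * c| <= `|x| * e.
Proof.
move=> df dfc; pose phi t := f (P + t *: S).
have dphi t : is_derive t (1 : R) phi ('D_S f (P + t *: S)) by apply: is_derive_line.
have cphi a b : {within `[a, b], continuous phi}.
  by apply: derivable_within_continuous => t _; have [] := dphi t.
(* The mean value theorem takes ordered endpoints; the two signs of [x] become the segments from 0
   to [x] and from [x] to 0. *)
have key a b : a <= b -> `|a| <= `|x| -> `|b| <= `|x| ->
    `|phi b - phi a - (b - a) * c| <= (b - a) * e.
  move=> ab ax bx.
  have [t] := @MVT_segment _ phi (fun t => 'D_S f (P + t *: S)) a b ab
    (fun t _ => dphi t) (cphi a b).
  rewrite in_itv/= => /andP[a_t tb] ->.
  rewrite mulrC -mulrBr normrM ger0_norm ?subr_ge0// ler_wpM2l ?subr_ge0// dfc//.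
  by move: ax bx; rewrite !ler_norml => /andP[? ?] /andP[? ?]; apply/andP; split; lra.
have phi0 : phi 0 = f P by rewrite /phi scale0r addr0.
rewrite -phi0 -/(phi x); have [x0|x0] := lerP 0 x.
  by have := key 0 x x0; rewrite normr0 subr0 => /(_ (normr_ge0 _) (lexx _)); rewrite (ger0_norm x0).
have := key x 0 (ltW x0) (lexx _); rewrite normr0 sub0r => /(_ (normr_ge0 _)).
rewrite (ltr0_norm x0) -normrN; congr (`|_| <= _); lra.
Qed.

(** Only derivatives along the directions [S i] are at hand, so the increment is followed along a
    broken line, one direction at a time. The bound by [rho] keeps the whole line in the ball where
    the derivatives are controlled. *)
Lemma sum_mean_value (I : Type) (r : seq I) (H : set V) (S : I -> V) (f : V -> R)
    (x c : I -> R) (e rho : R) (P0 P : V) :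
  (forall i Q t, H Q -> H (Q + t *: S i)) ->
  (forall i Q, H Q -> derivable f Q (S i)) ->
  (forall i Q, H Q -> `|Q - P0| <= rho -> `|'D_(S i) f Q - c i| <= e) ->
  H P -> `|P - P0| + \sum_(i <- r) `|x i| * `|S i| <= rho ->
  `|f (P + \sum_(i <- r) x i *: S i) - f P - \sum_(i <- r) x i * c i|
    <= (\sum_(i <- r) `|x i|) * e.
Proof.
move=> HS df dfc; elim: r P => [|i r IH] P HP.
  by rewrite !big_nil !addr0 subrr subr0 normr0 mul0r.
rewrite !big_cons => Prho; pose P' := P + x i *: S i.
have S0 : 0 <= \sum_(j <- r) `|x j| * `|S j| by apply: sumr_ge0 => j _; rewrite mulr_ge0.
have HP' : H P' by exact: HS.
have P'rho : `|P' - P0| + \sum_(j <- r) `|x j| * `|S j| <= rho.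
  have : `|P' - P0| <= `|P - P0| + `|x i| * `|S i|.
    by rewrite -normrZ /P' addrAC ler_normD.
  by lra.
have := IH _ HP' P'rho.
have : `|f P' - f P - x i * c i| <= `|x i| * e.
  apply: line_mean_value => t; first exact/df/HS.
  move=> tx; apply: dfc; first exact: HS.
  have : `|P + t *: S i - P0| <= `|P - P0| + `|t| * `|S i|.
    by rewrite -normrZ addrAC ler_normD.
  have : `|t| * `|S i| <= `|x i| * `|S i| by rewrite ler_wpM2r.
  by lra.
rewrite addrA -/P' mulrDl.
set a := f P'; set b := f P; set d := f _; set s := \sum_(_ <- _) _ * _.
move=> h1 h2; rewrite (_ : d - b - _ = (a - b - x i * c i) + (d - a - s)); last by ring.
exact: le_trans (ler_normD _ _) (lerD h1 h2).
Qed.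

End directional_mean_value.

(** * Matrix norms and compactness of the set of projectors *)

Section matrix_norm.
Context {R : realType} {n : nat}.
Local Notation M := 'M[R]_n.
Implicit Types A B P X : M.

Lemma le_mx_norm (A : M) i j : `|A i j| <= `|A|.
Proof.
by rewrite [leRHS]/Num.Def.normr /= mx_normrE; exact: (le_bigmax _ (fun ij : 'I_n * 'I_n => `|A ij.1 ij.2|) (i, j)).
Qed.

Lemma mx_norm_le (A : M) (e : R) : 0 <= e -> (forall i j, `|A i j| <= e) -> `|A| <= e.
Proof.
move=> e0 Ae; rewrite [leLHS]/Num.Def.normr /= mx_normrE.
by apply/bigmax_leP; split=> // -[i j] _; exact: Ae.
Qed.

Lemma mx_norm_mulmx A B : `|A *m B| <= n%:R * `|A| * `|B|.
Proof.
apply: mx_norm_le => [|i j]; first by rewrite !mulr_ge0.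
rewrite mxE (le_trans (ler_norm_sum _ _ _))//.
rewrite (le_trans (ler_sum _ (G := fun=> `|A| * `|B|) _))//.
  by move=> k _; rewrite normrM ler_pM// le_mx_norm.
by rewrite sumr_const card_ord -mulrA mulr_natl.
Qed.

Lemma frob_ip_norm A B : `|frob_ip A B| <= n%:R ^+ 2 * `|A| * `|B|.
Proof.
rewrite /frob_ip /mxtrace (le_trans (ler_norm_sum _ _ _))//.
rewrite (le_trans (ler_sum _ (G := fun=> n%:R * `|A| * `|B|) _))//.
  by move=> k _; rewrite (le_trans (le_mx_norm _ _ _))// mx_norm_mulmx.
by rewrite sumr_const card_ord -[leLHS]mulr_natl expr2 !mulrA.
Qed.

Lemma frob_sqr A : \tr (A^T *m A) = \sum_i \sum_j A j i ^+ 2.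
Proof.
rewrite /mxtrace; apply: eq_bigr => i _; rewrite mxE.
by apply: eq_bigr => j _; rewrite mxE expr2.
Qed.

Lemma frob_ge0 A : 0 <= frob A. Proof. exact: sqrtr_ge0. Qed.

Lemma mx_norm_le_frob A : `|A| <= frob A.
Proof.
apply: mx_norm_le => [|i j]; first exact: frob_ge0.
rewrite -sqrtr_sqr /frob frob_sqr ler_sqrt; last first.
  by apply: sumr_ge0 => ? _; apply: sumr_ge0 => ? _; exact: sqr_ge0.
rewrite (bigD1 j)//= (bigD1 i)//= -addrA lerDl addr_ge0//.
  by apply: sumr_ge0 => ? _; exact: sqr_ge0.
by apply: sumr_ge0 => ? _; apply: sumr_ge0 => ? _; exact: sqr_ge0.
Qed.

Lemma frob_le_mx_norm A : frob A <= n%:R * `|A|.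
Proof.
rewrite -(ger0_norm (_ : 0 <= n%:R * `|A|)) ?mulr_ge0// -sqrtr_sqr.
apply: ler_wsqrtr; rewrite frob_sqr.
rewrite (le_trans (ler_sum _ (G := fun=> n%:R * `|A| ^+ 2) _))//.
  move=> i _; rewrite (le_trans (ler_sum _ (G := fun=> `|A| ^+ 2) _))//.
    by move=> j _; rewrite -real_normK ?num_real// lerXn2r ?nnegrE// le_mx_norm.
  by rewrite sumr_const card_ord mulr_natl.
by rewrite sumr_const card_ord -[X in X <= _]mulr_natl mulrA -expr2 exprMn.
Qed.

Lemma mx_norm_sqr_le A : symmx A -> `|A| ^+ 2 <= frob_ip A A.
Proof.
move=> sA; rewrite /frob_ip -{2}sA.
have t0 : 0 <= \tr (A^T *m A).
  by rewrite frob_sqr; apply: sumr_ge0 => ? _; apply: sumr_ge0 => ? _; exact: sqr_ge0.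
by rewrite -[leRHS]sqr_sqrtr// lerXn2r ?nnegrE// ?sqrtr_ge0// mx_norm_le_frob.
Qed.

Lemma frobZ (h : R) A : frob (h *: A) = `|h| * frob A.
Proof.
rewrite /frob; have -> : (h *: A)^T *m (h *: A) = h ^+ 2 *: (A^T *m A).
  by rewrite -scalemxAr linearZ/= -scalemxAl scalerA expr2.
by rewrite mxtraceZ sqrtrM ?sqr_ge0// sqrtr_sqr.
Qed.

(** Heine-Borel for row vectors, transported by the continuous map [vec_mx], which preserves the
    maximum norm. *)
Lemma matrix_compact (K : set M) : bounded_set K -> closed K -> compact K.
Proof.
move=> bK clK; pose g : 'rV[R]_(n * n) -> M := vec_mx.
have cg : continuous g.
  move=> v s /nbhs_ballP[e /= e0 es]; apply/nbhs_ballP; exists e => //= w.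
  rewrite -ball_normE /= => vw; apply: es; rewrite -ball_normE /=.
  rewrite -(linearB (vec_mx : 'rV[R]_(n * n) -> M)) /=.
  apply: le_lt_trans vw; apply: mx_norm_le => // i j; rewrite mxE.
  rewrite [leRHS]/Num.Def.normr /= mx_normrE.
  exact: (le_bigmax _ (fun ij : 'I_1 * 'I_(n * n) => `|(v - w) ij.1 ij.2|) (0, mxvec_index i j)).
have -> : K = g @` (g @^-1` K).
  apply/seteqP; split=> [A KA|_ [v Kv <-]//].
  by exists (mxvec A); rewrite /g /= ?mxvecK.
apply: continuous_compact; first exact: continuous_subspaceT.
apply: bounded_closed_compact; last exact: closed_comp.
move: bK => [m [mr mK]]; exists m; split => // x mx v /= /mK-/(_ _ mx) vx.
have x0 : 0 <= x by exact: le_trans vx.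
rewrite [leLHS]/Num.Def.normr /= mx_normrE; apply/bigmax_leP; split => // -[i k] _ /=.
rewrite ord1; case/mxvec_indexP: k => a b.
by rewrite (le_trans _ vx)// -[v in leLHS]vec_mxK mxvecE le_mx_norm.
Qed.

(** An orthogonal projector of trace [N] has Frobenius norm the square root of [N], which gives
    boundedness. Closedness holds because the set is cut out by polynomial equations in the
    entries. *)
Lemma MN_compact N : compact (@MN R n N).
Proof.
apply: matrix_compact.
  exists (Num.sqrt N%:R); split; first exact: num_real.
  move=> x Nx P [sP [PP trP]] /=; rewrite (le_trans (mx_norm_le_frob _))//.
  by rewrite /frob sP PP trP ltW.
have cE i j : continuous (fun P : M => P i j) by exact: coord_continuous.
have csum (f : 'I_n -> M -> R) : (forall k, continuous (f k)) ->
    continuous (fun P => \sum_k f k P).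
  by move=> cf; apply: continuous_big => [|k _]; [exact: add_continuous|exact: cf].
have -> : MN N = (\bigcap_(ij in [set: 'I_n * 'I_n]) [set P : M | P ij.2 ij.1 - P ij.1 ij.2 = 0]) `&`
   (\bigcap_(ij in [set: 'I_n * 'I_n]) [set P : M | \sum_k P ij.1 k * P k ij.2 - P ij.1 ij.2 = 0]) `&`
   [set P : M | \sum_i P i i - N%:R = 0].
  apply/seteqP; split=> P /=.
    move=> [sP [PP trP]]; split; [split|].
    - by move=> [i j] _ /=; move: (sP) => /matrixP/(_ i j); rewrite mxE => ->; rewrite subrr.
    - by move=> [i j] _ /=; move: (PP) => /matrixP/(_ i j); rewrite mxE => ->; rewrite subrr.
    - by rewrite -trP /mxtrace subrr.
  move=> [[h1 h2] h3]; split; [|split].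
  - by apply/matrixP => i j; rewrite mxE; apply/eqP; rewrite -subr_eq0; apply/eqP; exact: (h1 (i, j)).
  - by apply/matrixP => i j; rewrite mxE; apply/eqP; rewrite -subr_eq0; apply/eqP; exact: (h2 (i, j)).
  - by apply/eqP; rewrite -subr_eq0; apply/eqP.
have c0 (f : M -> R) : continuous f -> closed [set P | f P = 0].
  by move=> cf; rewrite (_ : mkset _ = f @^-1` [set 0])//; apply: closed_comp => //; exact: closed_eq.
apply: closedI; [apply: closedI|].
- by apply: closed_bigI => -[i j] _; apply: c0 => P /=; exact: (cvgB (cE j i P) (cE i j P)).
- apply: closed_bigI => -[i j] _; apply: c0 => P.
  apply: (cvgB (csum (fun k P => P i k * P k j) _ P) (cE i j P)) => k Q.
  exact: (cvgM (cE i k Q) (cE k j Q)).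
- by apply: c0 => P; apply: (cvgB (csum (fun k P => P k k) _ P) (cvg_cst _)) => k; exact: cE.
Qed.

End matrix_norm.

Set Implicit Arguments. Unset Strict Implicit. Unset Printing Implicit Defensive.

Lemma dist_lt2 (R : realType) (V : normedModType R) (x y z : V) (e : R) :
  `|x - z| < e -> `|y - z| < e -> `|x - y| <= 2 * e.
Proof. by rewrite (distrC y) => xz zy; have := ler_distD z x y; lra. Qed.

(** * Calculus on symmetric matrices: local Lipschitz bounds *)

Section symmetric_matrices.
Context {R : realType} {n : nat}.
Local Notation M := 'M[R]_n.
Local Notation H := (@Hset R n).
Implicit Types A B P X : M.

(** Symmetrized matrix units. Indexing by all ordered pairs repeats the off-diagonal ones, but then
    the coefficients of a symmetric matrix are simply its entries. *)
Definition symE (p : 'I_n * 'I_n) : M :=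
  2^-1 *: (delta_mx p.1 p.2 + delta_mx p.2 p.1).

Lemma symmxD A B : symmx A -> symmx B -> symmx (A + B).
Proof. by rewrite /symmx linearD/= => -> ->. Qed.

Lemma symmxZ a A : symmx A -> symmx (a *: A).
Proof. by rewrite /symmx linearZ/= => ->. Qed.

Lemma symmxN A : symmx A -> symmx (- A).
Proof. by rewrite /symmx linearN/= => ->. Qed.

Lemma symmxB A B : symmx A -> symmx B -> symmx (A - B).
Proof. by move=> sA sB; apply: symmxD sA (symmxN sB). Qed.

Lemma symmx0 : symmx (0 : M).
Proof. exact: trmx0. Qed.

Lemma symm_symE p : symmx (symE p).
Proof. by rewrite /symmx /symE linearZ linearD/= !trmx_delta addrC. Qed.

Lemma symE_norm p : `|symE p| <= 1.
Proof.
rewrite /symE normrZ ger0_norm ?invr_ge0//.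
rewrite -ler_pdivlMl ?invr_gt0// invrK mulr1.
apply: mx_norm_le => // i j; rewrite !mxE.
by do 2!case: (_ && _); rewrite ?addr0 ?add0r ?normr1 ?normr0 ?ger0_norm ?ler1n ?lexx.
Qed.

Lemma symm_decomp X : symmx X -> X = \sum_p X p.1 p.2 *: symE p.
Proof.
move=> sX; have XE : X = \sum_p X p.1 p.2 *: delta_mx p.1 p.2.
  by rewrite {1}[X]matrix_sum_delta pair_bigA.
have XE' : X = \sum_p X p.1 p.2 *: delta_mx p.2 p.1.
  rewrite -{1}sX {1}XE linear_sum/=; apply: eq_bigr => p _.
  by rewrite linearZ/= trmx_delta.
transitivity (2^-1 *: (X + X)).
  by rewrite scalerDr -scalerDl (_ : 2^-1 + 2^-1 = 1) ?scale1r//; lra.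
rewrite {1}XE {2}XE' -big_split/= scaler_sumr; apply: eq_bigr => p _.
by rewrite /symE -scalerDr !scalerA mulrC.
Qed.

Lemma sum_symm_norm (X : M) (f : 'I_n * 'I_n -> R) (e : R) :
  (forall p, 0 <= f p <= e) ->
  \sum_p `|X p.1 p.2| * f p <= n%:R ^+ 2 * `|X| * e.
Proof.
move=> fe; rewrite (le_trans (ler_sum _ (G := fun=> `|X| * e) _))//.
  by move=> p _; have /andP[f0 f1] := fe p; rewrite ler_pM// le_mx_norm.
by rewrite sumr_const card_prod card_ord -[leLHS]mulr_natl natrM expr2 mulrA.
Qed.

(** There are [n ^ 2] directions [symE p], each of norm at most 1, so the broken line has length at
    most [n ^ 2] times the norm of [X]. *)
Lemma symm_mean_value (f : M -> R) (c : 'I_n * 'I_n -> R) (P0 P X : M) (e rho : R) :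
  (forall p Q, symmx Q -> derivable f Q (symE p)) ->
  (forall p Q, symmx Q -> `|Q - P0| <= rho -> `|'D_(symE p) f Q - c p| <= e) ->
  0 <= e -> symmx P -> symmx X -> `|P - P0| + n%:R ^+ 2 * `|X| <= rho ->
  `|f (P + X) - f P - \sum_p X p.1 p.2 * c p| <= n%:R ^+ 2 * `|X| * e.
Proof.
move=> df dfc e0 sP sX Xrho.
have := @sum_mean_value R M _ (index_enum _) H symE f (fun p => X p.1 p.2) c e rho P0 P.
rewrite -symm_decomp// => /(_ _ df dfc sP) mv.
apply: le_trans (mv _ _) _.
- by move=> p Q t sQ; apply: symmxD sQ (symmxZ _ (symm_symE _)).
- rewrite (le_trans _ Xrho)// lerD2l -[leRHS]mulr1; apply: sum_symm_norm => // p.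
  by rewrite normr_ge0 symE_norm.
- by rewrite mulr_suml; apply: sum_symm_norm => p; rewrite e0 lexx.
Qed.

Lemma near_within_H (I : finType) (W : normedModType R) (f : I -> M -> W) P0 (e : R) :
  (forall i, {within H, continuous (f i)}) -> symmx P0 -> 0 < e ->
  exists2 r, 0 < r & forall Q, symmx Q -> `|Q - P0| < r -> forall i, `|f i Q - f i P0| < e.
Proof.
move=> cf sP0 e0.
have : \forall Q \near P0, forall i, symmx Q -> `|f i Q - f i P0| < e.
  apply: (@filter_forall _ I (fun i Q => symmx Q -> `|f i Q - f i P0| < e) (nbhs P0)) => i.
  have /subspace_continuousP/(_ P0 sP0)/cvgrPdist_lt/(_ _ e0) := cf i.
  by apply: filterS => Q PQ; rewrite distrC.
move=> /nbhs_ballP[r /= r0 Pr]; exists r => // Q sQ QP i; apply: Pr => //.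
by rewrite -ball_normE /= distrC.
Qed.

Lemma C1_locally_lipschitz (I : finType) (f : I -> M -> R) P0 :
  (forall i p Q, symmx Q -> derivable (f i) Q (symE p)) ->
  (forall i p, {within H, continuous ('D_(symE p) (f i) : M -> R)}) ->
  symmx P0 ->
  exists r L, [/\ 0 < r, 0 <= L & forall P Q, symmx P -> symmx Q ->
    `|P - P0| < r -> `|Q - P0| < r -> forall i, `|f i P - f i Q| <= L * `|P - Q|].
Proof.
move=> df cdf sP0.
pose g (ip : I * ('I_n * 'I_n)) : M -> R := 'D_(symE ip.2) (f ip.1).
have [r r0 gr] := near_within_H (f := g) (fun ip => cdf ip.1 ip.2) sP0 ltr01.
(* Bounds all the derivatives on the ball of radius [r]: their values at [P0] plus a variation less
   than 1. *)
pose B := 1 + \sum_ip `|g ip P0|.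
have B0 : 0 <= B by rewrite addr_ge0// sumr_ge0.
have k0 : 0 < 2 * n%:R ^+ 2 + 1 :> R by rewrite ltr_wpDl// mulr_ge0// exprn_ge0.
have n2 : 0 <= n%:R ^+ 2 :> R by rewrite exprn_ge0.
(* A broken line starting within [r'] of [P0] and joining points at distance at most [2 * r'] then
   stays within [r / 2] of [P0]. *)
pose r' := r / 2 / (2 * n%:R ^+ 2 + 1).
have r'0 : 0 < r' by rewrite !divr_gt0.
have r'E : r' + n%:R ^+ 2 * (2 * r') = r / 2.
  by rewrite -[r / 2](divfK (lt0r_neq0 k0)) -/r'; ring.
exists r', (n%:R ^+ 2 * B); split => //; first by rewrite mulr_ge0.
move=> P Q sP sQ PP0 QP0 i.
have PQ : `|P - Q| <= 2 * r'.
  exact: dist_lt2 PP0 QP0.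
have S0 : \sum_p (P - Q) p.1 p.2 * 0 = 0 by rewrite big1// => p _; rewrite mulr0.
have := @symm_mean_value (f i) (fun=> 0) P0 Q (P - Q) B (r / 2) (df i) _ B0 sQ (symmxB sP sQ) _.
rewrite (addrC Q (P - Q)) subrK S0 subr0 (mulrAC (n%:R ^+ 2) B) => -> //.
  move=> p T sT TP0; rewrite subr0.
  have : `|g (i, p) P0| <= \sum_ip `|g ip P0|.
    by rewrite (bigD1 (i, p))//= lerDl sumr_ge0.
  have TP0r : `|T - P0| < r by move: TP0 r0; lra.
  have := gr T sT TP0r (i, p); rewrite /B /g /=.
  have := ler_normD ('D_(symE p) (f i) T - 'D_(symE p) (f i) P0) ('D_(symE p) (f i) P0).
  by rewrite subrK; lra.
by rewrite -r'E; apply: lerD; [exact: ltW|exact: ler_wpM2l].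
Qed.

(** Entries of the gradient are first derivatives of [E], so the second derivatives of [E] control
    how the gradient varies. *)
Lemma gradE_entry (E : M -> R) (gradE : M -> M) P i j :
  is_frob_gradient E gradE -> symmx P -> gradE P i j = 'D_(symE (i, j)) E P.
Proof.
move=> gE sP; have [sG ->] := gE P sP; last exact: symm_symE.
have tr k l : \tr (gradE P *m delta_mx k l) = gradE P l k.
  rewrite /mxtrace (bigD1 l)//= mxE (bigD1 k)//= !mxE !eqxx mulr1 big1 ?addr0.
    rewrite big1 ?addr0// => m ml; rewrite mxE big1// => o _.
    by rewrite mxE (negbTE ml) andbF mulr0.
  by move=> m mk; rewrite mxE (negbTE mk) mulr0.
rewrite /frob_ip /symE /= -scalemxAr mxtraceZ mulmxDr mxtraceD !tr.
by rewrite -{1 3}sG mxE; lra.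
Qed.

Lemma frob_gradient_locally_lipschitz (E : M -> R) (gradE : M -> M) P0 :
  C2_on_H E -> is_frob_gradient E gradE -> symmx P0 ->
  exists r L, [/\ 0 < r, 0 <= L & forall P Q, symmx P -> symmx Q ->
    `|P - P0| < r -> `|Q - P0| < r -> `|gradE P - gradE Q| <= L * `|P - Q|].
Proof.
move=> E2 gE sP0.
have [||//|r [L [r0 L0 lip]]] := @C1_locally_lipschitz ('I_n * 'I_n)%type (fun p => 'D_(symE p) E) P0.
- by move=> p q; have [_ [_ [+ _]]] := E2 _ _ (symm_symE p) (symm_symE q).
- by move=> p q; have [_ [_ [_ +]]] := E2 _ _ (symm_symE p) (symm_symE q).
exists r, L; split => // P Q sP sQ PP0 QP0; apply: mx_norm_le => [|i j].
  by rewrite mulr_ge0.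
by rewrite !mxE !(gradE_entry _ _ gE)//; exact: (lip _ _ sP sQ PP0 QP0 (i, j)).
Qed.

Lemma energy_locally_lipschitz (E : M -> R) P0 :
  C2_on_H E -> symmx P0 ->
  exists r L, [/\ 0 < r, 0 <= L & forall P Q, symmx P -> symmx Q ->
    `|P - P0| < r -> `|Q - P0| < r -> `|E P - E Q| <= L * `|P - Q|].
Proof.
move=> E2 sP0.
have [||//|r [L [r0 L0 lip]]] := @C1_locally_lipschitz unit (fun=> E) P0.
- by move=> _ p; have [+ _] := E2 _ _ (symm_symE p) (symm_symE p).
- by move=> _ p; have [_ [+ _]] := E2 _ _ (symm_symE p) (symm_symE p).
by exists r, L; split => // P Q sP sQ PP0 QP0; exact: (lip _ _ sP sQ PP0 QP0 tt).
Qed.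

Lemma PiPD P X Y : PiP P (X + Y) = PiP P X + PiP P Y.
Proof. by rewrite /PiP !(mulmxDr _ X Y) (mulmxDl (P *m X)) (mulmxDl (_ *m X) (_ *m Y) P) addrACA. Qed.

Lemma PiPZ P a X : PiP P (a *: X) = a *: PiP P X.
Proof. by rewrite /PiP -!scalemxAr -!scalemxAl -scalerDr. Qed.

Lemma PiPN P X : PiP P (- X) = - PiP P X.
Proof. by rewrite -scaleN1r PiPZ scaleN1r. Qed.

Lemma PiP0 P : PiP P 0 = 0.
Proof. by rewrite -[X in PiP P X](scale0r (0 : M)) PiPZ scale0r. Qed.

Lemma PiP_sum P (I : finType) (X : I -> M) : PiP P (\sum_i X i) = \sum_i PiP P (X i).
Proof. by apply: (big_morph (PiP P)) => [X' Y|]; [exact: PiPD|exact: PiP0]. Qed.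

(** * First-order behaviour of the retraction *)

Section retraction.
Variables (N : nat) (Rt : M -> M).
Hypothesis retr : forall P, MN N P -> exists delta C : R, 0 < delta /\
  forall X, symmx X -> frob X < delta -> MN N (Rt (P + X)) /\
    frob (Rt (P + X) - P - PiP P X) <= C * frob X ^+ 2.

Lemma retraction_fix P : MN N P -> Rt P = P.
Proof.
move=> /retr[d [C [d0 /(_ _ symmx0)]]].
have f0 : frob (0 : M) = 0 by rewrite /frob trmx0 mul0mx mxtrace0 sqrtr0.
rewrite f0 addr0 PiP0 subr0 expr0n mulr0 => /(_ d0)[_ h].
apply/eqP; rewrite -subr_eq0 -normr_le0; exact: le_trans (mx_norm_le_frob _) h.
Qed.

Lemma derive_retraction P S : MN N P -> symmx S -> 'D_S Rt P = PiP P S.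
Proof.
move=> NP sS; have [d [C [d0 dC]]] := retr NP.
apply/cvg_lim => //; apply/cvgrPdist_lt => e e0.
(* The sign of [C] is unknown, hence the absolute value; the added 1 permits division by [C']. *)
pose C' := `|C| * frob S ^+ 2 + 1.
have C'0 : 0 < C' by rewrite ltr_wpDl// mulr_ge0// exprn_ge0// frob_ge0.
have S0 : 0 < frob S + 1 by rewrite ltr_wpDl// frob_ge0.
near=> h.
have h0 : h != 0 by near: h; exact: nbhs_dnbhs_neq.
have he : `|h| < e / C' by near: h; apply: dnbhs0_lt; rewrite divr_gt0.
have hd : `|h| < d / (frob S + 1) by near: h; apply: dnbhs0_lt; rewrite divr_gt0.
have [|_] := dC (h *: S) (symmxZ h sS).
  rewrite frobZ; move: hd; rewrite ltr_pdivlMr//; apply: le_lt_trans.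
  by rewrite ler_wpM2l// lerDl.
rewrite frobZ PiPZ exprMn => hC.
rewrite /= (retraction_fix NP) (addrC (h *: S)).
have -> : PiP P S - h^-1 *: (Rt (P + h *: S) - P) = - (h^-1 *: (Rt (P + h *: S) - P - h *: PiP P S)).
  by rewrite [in RHS]scalerBr scalerA mulVf// scale1r opprB.
rewrite normrN normrZ normfV ltr_pdivrMl ?normr_gt0//.
apply: le_lt_trans (le_trans (mx_norm_le_frob _) hC) _.
have : `|h| * C' < e by rewrite -ltr_pdivlMr.
have hp : 0 < `|h| by rewrite normr_gt0.
move=> hCe; apply: (@le_lt_trans _ _ (`|h| * (`|h| * C'))); last by rewrite ltr_pM2l.
rewrite mulrCA expr2 -mulrA; apply: ler_wpM2l => //; apply: ler_wpM2l => //.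
rewrite /C'; have : C * frob S ^+ 2 <= `|C| * frob S ^+ 2.
  by rewrite ler_wpM2r ?ler_norm// exprn_ge0// frob_ge0.
by lra.
Unshelve. all: by end_near. Qed.

(** The constants of the quadratic expansion depend on [P], so it serves only to identify the
    derivative at [P]. Uniformity comes from continuity of the derivatives at [P0], at the price of
    an error [e] times the norm of [X] in place of a quadratic one. *)
Lemma retraction_locally_uniform P0 (e : R) : C2_on_H Rt -> MN N P0 -> 0 < e ->
  exists2 r, 0 < r & forall P X, MN N P -> symmx X ->
    `|P - P0| < r -> `|X| < r -> `|Rt (P + X) - P - PiP P X| <= e * `|X|.
Proof.
move=> R2 NP0 e0; have sP0 := NP0.1.
have k0 : 0 < n%:R ^+ 2 + 1 :> R by rewrite ltr_wpDl// exprn_ge0.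
(* Derivatives at two points near [P0] differ by at most [2 * e'], and [n ^ 2] directions
   contribute. *)
pose e' := e / (n%:R ^+ 2 + 1) / 2.
have e'0 : 0 < e' by rewrite !divr_gt0.
have [r r0 gr] := @near_within_H _ M (fun p => 'D_(symE p) Rt) P0 e'
  (fun p => (R2 _ _ (symm_symE p) (symm_symE p)).2.1) sP0 e'0.
pose r' := r / 2 / (n%:R ^+ 2 + 1).
have r'0 : 0 < r' by rewrite !divr_gt0.
exists r' => // P X NP sX PP0 Xr.
have sP := NP.1.
have r'E : r' + n%:R ^+ 2 * r' = r / 2.
  by rewrite -[r / 2](divfK (lt0r_neq0 k0)) -/r'; ring.
have r'r : r' <= r / 2 by rewrite -r'E lerDl mulr_ge0// ?exprn_ge0// ltW.
have e'E : n%:R ^+ 2 * (2 * e') <= e.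
  rewrite -[leRHS](divfK (lt0r_neq0 k0)) (_ : 2 * e' = e / (n%:R ^+ 2 + 1)).
    by rewrite mulrC ler_wpM2l ?lerDl// divr_ge0// ltW.
  by rewrite /e' [LHS]mulrC divfK ?pnatr_eq0.
apply: mx_norm_le => [|i j]; first by rewrite mulr_ge0// ltW.
(* The mean value inequality is for real-valued functions, so each entry is treated separately. *)
pose f (Q : M) := Rt Q i j.
have dR Q S : symmx Q -> symmx S -> derivable Rt Q S.
  by move=> sQ sS; have [+ _] := R2 _ _ sS sS; exact.
have Df Q S : symmx Q -> symmx S -> 'D_S f Q = ('D_S Rt Q) i j.
  by move=> sQ sS; rewrite derive_mx ?mxE//; exact: dR.
have := @symm_mean_value f (fun p => (PiP P (symE p)) i j) P0 P X (2 * e') (r / 2) _ _ _ sP sX _.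
rewrite {1}/f (_ : \sum_p _ = PiP P X i j); last first.
  rewrite [in RHS](symm_decomp sX) PiP_sum summxE; apply: eq_bigr => p _.
  by rewrite PiPZ [in RHS]mxE.
rewrite /f (retraction_fix NP) !mxE => mv; apply: le_trans (mv _ _ _ _) _.
- by move=> p Q sQ; exact: ((derivable_mxP Rt Q (symE p)).1 (dR Q _ sQ (symm_symE p)) i j).
- move=> p Q sQ QP0; rewrite -(derive_retraction NP (symm_symE p)) -/f.
  rewrite -/f Df//; last exact: symm_symE.
  have h1 : `|Q - P0| < r by move: QP0 r0; lra.
  have h2 : `|P - P0| < r by move: PP0 r'r r0; lra.
  have := dist_lt2 (gr Q sQ h1 p) (gr P sP h2 p).
  apply: le_trans; move: ('D_(symE p) Rt Q) ('D_(symE p) Rt P) => A B.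
  by have := le_mx_norm (A - B) i j; rewrite !mxE.
- by rewrite mulr_ge0// ltW.
- by rewrite -r'E; apply: lerD; [exact: ltW|apply: ler_wpM2l; [exact: exprn_ge0|exact: ltW]].
- by rewrite mulrAC ler_wpM2r.
Qed.

End retraction.
End symmetric_matrices.

(** * Algebra and norm bounds for the tangent projection *)

Section tangent_projection.
Context {R : realType} {n : nat}.
Local Notation M := 'M[R]_n.
Implicit Types A B P X Y : M.

Lemma symm_PiP P X : symmx P -> symmx X -> symmx (PiP P X).
Proof.
move=> sP sX; rewrite /symmx /PiP linearD/= !trmx_mul linearB/= trmx1 sP sX.
by rewrite addrC !mulmxA.
Qed.

(** Self-adjointness: cyclicity of the trace exchanges the two off-diagonal blocks. *)
Lemma frob_ip_PiP P A B : frob_ip (PiP P A) B = frob_ip A (PiP P B).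
Proof.
rewrite /frob_ip /PiP; move: (1%:M - P) => Q.
rewrite mulmxDl mulmxDr !mxtraceD addrC.
by congr (_ + _); rewrite -!mulmxA mxtrace_mulC !mulmxA.
Qed.

Lemma PiP_idem P X : P *m P = P -> PiP P (PiP P X) = PiP P X.
Proof.
move=> PP; have PQ : P *m (1%:M - P) = 0 by rewrite mulmxBr mulmx1 PP subrr.
have QP : (1%:M - P) *m P = 0 by rewrite mulmxBl mul1mx PP subrr.
have QQ : (1%:M - P) *m (1%:M - P) = 1%:M - P by rewrite mulmxBr mulmx1 QP subr0.
rewrite /PiP; move: (1%:M - P) PQ QP QQ => Q PQ QP QQ.
rewrite !mulmxDr !mulmxDl !mulmxA PP QQ PQ QP !mul0mx addr0 add0r.
by rewrite -!mulmxA PP QQ.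
Qed.

(* The component of a chord of idempotents normal to the tangent space is quadratic in the chord. *)
Lemma normal_chord P Y : P *m P = P -> Y *m Y = Y ->
  (Y - P) - PiP P (Y - P) =
  (1%:M - P) *m ((Y - P) *m (Y - P)) *m (1%:M - P) - P *m ((Y - P) *m (Y - P)) *m P.
Proof.
move=> PP YY.
have E1 Z : Z *m P *m P = Z *m P by rewrite -mulmxA PP.
have E2 Z : Z *m Y *m Y = Z *m Y by rewrite -mulmxA YY.
rewrite /PiP !(mulmxBr, mulmxBl, mul1mx, mulmx1, mulmxA).
rewrite !(E1, E2, PP, YY).
move: (P *m Y *m P) (P *m Y) (Y *m P) => a b c.
by apply/matrixP => i j; rewrite !mxE; ring.
Qed.

Lemma mx_norm_mulmx3 A B X : `|A *m B *m X| <= n%:R ^+ 2 * (`|A| * `|B| * `|X|).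
Proof.
rewrite (le_trans (mx_norm_mulmx _ _))// (le_trans (_ : _ <= n%:R * (n%:R * `|A| * `|B|) * `|X|))//.
  by rewrite ler_wpM2r// ler_wpM2l// mx_norm_mulmx.
by rewrite expr2 !mulrA.
Qed.

Variable (N : nat).
(** A common bound for the norms of [P] and [1%:M - P] on [MN N]. *)
Let b : R := 1 + Num.sqrt N%:R.

Lemma MN_norm_bound P : MN N P -> `|P| <= b /\ `|1%:M - P| <= b.
Proof.
move=> [sP [PP trP]].
have P1 : `|P| <= Num.sqrt N%:R.
  by rewrite (le_trans (mx_norm_le_frob _))// /frob sP PP trP.
split; first by rewrite (le_trans P1)// /b lerDr.
rewrite (le_trans (ler_normB _ _))// lerD//; apply: mx_norm_le => // i j.
by rewrite mxE; case: (_ == _); rewrite ?normr1 ?normr0.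
Qed.

Let b0 : 0 <= b. Proof. by rewrite addr_ge0// sqrtr_ge0. Qed.

Lemma PiP_norm P X : MN N P -> `|PiP P X| <= 2 * n%:R ^+ 2 * b ^+ 2 * `|X|.
Proof.
move=> /MN_norm_bound[P1 P2]; rewrite /PiP (le_trans (ler_normD _ _))//.
have h A B : `|A| <= b -> `|B| <= b -> `|A *m X *m B| <= n%:R ^+ 2 * b ^+ 2 * `|X|.
  move=> Ab Bb; rewrite (le_trans (mx_norm_mulmx3 _ _ _))//.
  rewrite (_ : _ * b ^+ 2 * _ = n%:R ^+ 2 * (b * `|X| * b)); last by ring.
  by rewrite ler_wpM2l ?exprn_ge0// ler_pM// ?mulr_ge0// ler_wpM2r.
rewrite (_ : 2 * _ * _ * _ = n%:R ^+ 2 * b ^+ 2 * `|X| + n%:R ^+ 2 * b ^+ 2 * `|X|); last by ring.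
by rewrite lerD ?h.
Qed.

Lemma normal_chord_norm P Y : MN N P -> MN N Y ->
  `|(Y - P) - PiP P (Y - P)| <= 2 * n%:R ^+ 3 * b ^+ 2 * `|Y - P| ^+ 2.
Proof.
move=> NP NY; have [P1 P2] := MN_norm_bound NP.
case: NP => _ [PP _]; case: NY => _ [YY _].
rewrite normal_chord// (le_trans (ler_normB _ _))//.
set D := Y - P.
have h A : `|A| <= b -> `|A *m (D *m D) *m A| <= n%:R ^+ 3 * b ^+ 2 * `|D| ^+ 2.
  move=> Ab; rewrite (le_trans (mx_norm_mulmx3 _ _ _))//.
  rewrite (_ : n%:R ^+ 3 * b ^+ 2 * _ = n%:R ^+ 2 * (b * (n%:R * `|D| * `|D|) * b)); last by ring.
  rewrite ler_wpM2l ?exprn_ge0// ler_pM// ?mulr_ge0// ler_pM//.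
  exact: mx_norm_mulmx.
rewrite (_ : 2 * _ * _ * _ = n%:R ^+ 3 * b ^+ 2 * `|D| ^+ 2 + n%:R ^+ 3 * b ^+ 2 * `|D| ^+ 2); last by ring.
by rewrite lerD ?h.
Qed.

Lemma PiP_base_norm P Q X : MN N P -> MN N Q ->
  `|PiP P X - PiP Q X| <= 4 * n%:R ^+ 2 * b * `|X| * `|P - Q|.
Proof.
move=> /MN_norm_bound[P1 P2] /MN_norm_bound[Q1 Q2].
(* Telescoping: one occurrence of the projector is changed at a time. *)
have -> : PiP P X - PiP Q X = (P - Q) *m X *m (1%:M - P) - Q *m X *m (P - Q)
    - (P - Q) *m X *m P + (1%:M - Q) *m X *m (P - Q).
  rewrite /PiP !(mulmxBr, mulmxBl, mul1mx, mulmx1).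
  move: (P *m X *m P) (Q *m X *m Q) (P *m X *m Q) (Q *m X *m P) => a a' c d.
  move: (P *m X) (X *m P) (Q *m X) (X *m Q) => f g h k.
  by apply/matrixP => i j; rewrite !mxE; ring.
pose k := n%:R ^+ 2 * (b * `|X| * `|P - Q|).
have h A B : `|A| <= `|P - Q| -> `|B| <= b -> `|A *m X *m B| <= k.
  move=> Ab Bb; rewrite (le_trans (mx_norm_mulmx3 _ _ _))// ler_wpM2l ?exprn_ge0//.
  rewrite (_ : b * _ * _ = `|P - Q| * `|X| * b); last by ring.
  by rewrite ler_pM// ?mulr_ge0// ler_wpM2r.
have h' A B : `|A| <= b -> `|B| <= `|P - Q| -> `|A *m X *m B| <= k.
  move=> Ab Bb; rewrite (le_trans (mx_norm_mulmx3 _ _ _))// ler_wpM2l ?exprn_ge0//.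
  by rewrite ler_pM// ?mulr_ge0// ler_wpM2r.
rewrite (_ : 4 * _ * _ * _ * _ = k + k + k + k); last by rewrite /k; ring.
rewrite (le_trans (ler_normD _ _))// lerD ?h'//.
rewrite (le_trans (ler_normB _ _))// lerD ?h//.
by rewrite (le_trans (ler_normB _ _))// lerD//; [exact: h|exact: h'].
Qed.

End tangent_projection.

(** * Energy decrease in one step, and passage to the limit *)

Section gradient_step.
Context {R : realType} {n : nat}.
Local Notation M := 'M[R]_n.
Variables (N : nat) (E : M -> R) (gradE Rt : M -> M).
Hypotheses (E2 : C2_on_H E) (gE : is_frob_gradient E gradE) (R2 : C2_on_H Rt).
Hypothesis retr : forall P, MN N P -> exists delta C : R, 0 < delta /\
  forall X, symmx X -> frob X < delta -> MN N (Rt (P + X)) /\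
    frob (Rt (P + X) - P - PiP P X) <= C * frob X ^+ 2.
Let b : R := 1 + Num.sqrt N%:R.
Let T P := PiP P (gradE P).

(** The descent lemma. The mean value theorem gives the constant [L] where integration would give
    half of it; [n ^ 2] comes from bounding the inner product by maximum norms. *)
Lemma energy_quadratic_bound P0 P D (r L : R) : symmx P -> symmx D ->
  (forall P Q, symmx P -> symmx Q -> `|P - P0| < r -> `|Q - P0| < r ->
    `|gradE P - gradE Q| <= L * `|P - Q|) -> 0 <= L ->
  `|P - P0| + `|D| < r ->
  E (P + D) - E P <= frob_ip (gradE P) D + n%:R ^+ 2 * L * `|D| ^+ 2.
Proof.
move=> sP sD lip L0 PD.
have sPt t : symmx (P + t *: D) by apply: symmxD sP (symmxZ t sD).
have := @line_mean_value R M E P D 1 (frob_ip (gradE P) D) (n%:R ^+ 2 * L * `|D| ^+ 2).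
rewrite scale1r mul1r normr1 mul1r => mv.
rewrite -lerBlDl; apply: le_trans (ler_norm _) (mv _ _).
  by move=> t; have [dE _] := E2 sD sD; exact: dE.
move=> t t1; rewrite ((gE (sPt t)).2 D sD).
have -> : frob_ip (gradE (P + t *: D)) D - frob_ip (gradE P) D =
    frob_ip (gradE (P + t *: D) - gradE P) D by rewrite /frob_ip mulmxBl linearB.
rewrite (le_trans (frob_ip_norm _ _))//.
have tD : `|t *: D| <= `|D| by rewrite normrZ ler_piMl.
have h : `|gradE (P + t *: D) - gradE P| <= L * `|D|.
  rewrite (le_trans (lip _ _ (sPt t) sP _ _))//.
  - rewrite addrAC; apply: le_lt_trans (ler_normD _ _) _.
    by move: tD PD; lra.
  - by apply: le_lt_trans PD; rewrite lerDl.
  - by rewrite (addrC P) addrK ler_wpM2l.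
rewrite (_ : _ * L * _ = n%:R ^+ 2 * (L * `|D|) * `|D|); last by ring.
by rewrite ler_wpM2r// ler_wpM2l// exprn_ge0.
Qed.

(* The summand with g accounts for the curvature of MN, the one with L for that of E. *)
Lemma energy_decrease P0 P Y (r L g beta : R) :
  MN N P -> MN N Y ->
  (forall P Q, symmx P -> symmx Q -> `|P - P0| < r -> `|Q - P0| < r ->
    `|gradE P - gradE Q| <= L * `|P - Q|) -> 0 <= L ->
  `|gradE P| <= g -> 0 < beta ->
  `|P - P0| + 2 * beta * `|T P| < r ->
  `|Y - P + beta *: T P| <= (4 * (n%:R ^+ 2 + 1))^-1 * (beta * `|T P|) ->
  16 * n%:R ^+ 2 * (g * (2 * n%:R ^+ 3 * b ^+ 2) + L) * beta <= 1 ->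
  E Y <= E P - beta / 2 * `|T P| ^+ 2 /\ `|Y - P| <= 2 * beta * `|T P|.
Proof.
move=> NP NY lip L0 gP b0 Pr Yr bK.
have sP := NP.1; have sY := NY.1.
have [PP YY] := (NP.2.1, NY.2.1).
have [sG _] := gE sP.
have n2 : 0 <= n%:R ^+ 2 :> R by exact: exprn_ge0.
have n3 : 0 <= n%:R ^+ 3 :> R by exact: exprn_ge0.
have bb : 0 <= b ^+ 2 by exact: sqr_ge0.
have g0 : 0 <= g by exact: le_trans gP.
have t0 : 0 <= `|T P| by [].
have bt : 0 <= beta * `|T P| by rewrite mulr_ge0// ltW.
set t := `|T P| in Pr Yr t0 bt *.
set eps := (4 * _)^-1 in Yr.
have k0 : 0 < 4 * (n%:R ^+ 2 + 1) :> R by rewrite mulr_gt0// ltr_wpDl.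
have eps0 : 0 <= eps by rewrite invr_ge0 ltW.
(* The retraction error may thus spend a quarter of the first-order decrease. *)
have epsn : n%:R ^+ 2 * eps <= 1 / 4.
  rewrite /eps ler_pdivrMr//; lra.
have eps1 : eps <= 1.
  by rewrite /eps invf_le1//; lra.
set D := Y - P in Yr *.
set Q := D + beta *: T P in Yr.
have sD : symmx D by exact: symmxB.
have DQ : D = - (beta *: T P) + Q by rewrite /Q addrCA addNr addr0.
have Dt : `|D| <= 2 * beta * t.
  have : `|D| <= beta * t + eps * (beta * t).
    rewrite {1}DQ; apply: le_trans (ler_normD _ _) _.
    by rewrite normrN normrZ gtr0_norm// lerD.
  have : eps * (beta * t) <= 1 * (beta * t) by rewrite ler_wpM2r.
  by lra.
split => //.
have EY := energy_quadratic_bound sP sD lip L0 _.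
have {EY} EY : E Y - E P <= frob_ip (gradE P) D + n%:R ^+ 2 * L * `|D| ^+ 2.
  have <- : P + D = Y by rewrite /D addrC subrK.
  by apply: EY; apply: le_lt_trans Pr; rewrite lerD2l.
have D2 : `|D| ^+ 2 <= 4 * beta ^+ 2 * t ^+ 2.
  rewrite (_ : 4 * _ * _ = (2 * beta * t) ^+ 2); last by ring.
  by rewrite lerXn2r// nnegrE// mulr_ge0// mulr_ge0// ltW.
have ipD X A B : frob_ip X (A + B) = frob_ip X A + frob_ip X B.
  by rewrite /frob_ip mulmxDr linearD.
(* By self-adjointness the left side pairs [T P] with [D]. The part [- (beta *: T P)] of [D] yields
   the decrease, the remainder [Q] costs at most a quarter of it. *)
have tangent : frob_ip (gradE P) (PiP P D) <= - beta * t ^+ 2 + beta * t ^+ 2 / 4.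
  rewrite -frob_ip_PiP -/(T P) {1}DQ ipD; apply: lerD.
    rewrite /frob_ip -scaleNr -scalemxAr mxtraceZ !mulNr lerN2 ler_wpM2l ?(ltW b0)//.
    exact: (mx_norm_sqr_le _ (symm_PiP sP sG)).
  apply: le_trans (ler_norm _) _; apply: le_trans (frob_ip_norm _ _) _.
  rewrite -/t; apply: (@le_trans _ _ (n%:R ^+ 2 * t * (eps * (beta * t)))).
    by rewrite ler_wpM2l// mulr_ge0.
  rewrite (_ : _ * t * _ = n%:R ^+ 2 * eps * (beta * t ^+ 2)); last by ring.
  rewrite (_ : beta * _ / 4 = 1 / 4 * (beta * t ^+ 2)); last by ring.
  by rewrite ler_wpM2r// mulr_ge0// ?sqr_ge0// ltW.
have normal : frob_ip (gradE P) (D - PiP P D) <=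
    n%:R ^+ 2 * (g * (2 * n%:R ^+ 3 * b ^+ 2)) * `|D| ^+ 2.
  apply: le_trans (ler_norm _) _; apply: le_trans (frob_ip_norm _ _) _.
  rewrite (_ : _ * (g * _) * _ = n%:R ^+ 2 * g * (2 * n%:R ^+ 3 * b ^+ 2 * `|D| ^+ 2)); last by ring.
  by rewrite ler_pM ?mulr_ge0//; [exact: ler_wpM2l|exact: normal_chord_norm NP NY].
have split_D : frob_ip (gradE P) D = frob_ip (gradE P) (PiP P D) + frob_ip (gradE P) (D - PiP P D).
  by rewrite -ipD addrC subrK.
set K := g * (2 * n%:R ^+ 3 * b ^+ 2) in bK normal.
have K0 : 0 <= K by rewrite /K mulr_ge0// mulr_ge0// mulr_ge0.
have h1 : n%:R ^+ 2 * (K + L) * `|D| ^+ 2 <= n%:R ^+ 2 * (K + L) * (4 * beta ^+ 2 * t ^+ 2).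
  by rewrite ler_wpM2l// mulr_ge0// addr_ge0.
(* Curvature of the manifold and of [E] together spend another quarter, which leaves half of the
   decrease. *)
have h2 : n%:R ^+ 2 * (K + L) * (4 * beta ^+ 2 * t ^+ 2) <= 1 / 4 * (beta * t ^+ 2).
  rewrite (_ : _ * (4 * _ * _) = (16 * n%:R ^+ 2 * (K + L) * beta) / 4 * (beta * t ^+ 2)); last by field.
  by rewrite ler_wpM2r ?mulr_ge0 ?sqr_ge0 ?(ltW b0)// ler_wpM2r.
move: EY tangent normal h1 h2; rewrite split_D.
move: (frob_ip _ _) (frob_ip _ _) => u v.
have -> : n%:R ^+ 2 * (K + L) * `|D| ^+ 2 = n%:R ^+ 2 * K * `|D| ^+ 2 + n%:R ^+ 2 * L * `|D| ^+ 2 by ring.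
move: (n%:R ^+ 2 * K * _) (n%:R ^+ 2 * L * _) (_ * (4 * _ * _)) => w x y.
by rewrite mulNr (_ : beta / 2 * t ^+ 2 = beta * t ^+ 2 / 2); [lra|ring].
Qed.

(** Quantifying over all [beta] up to [r] makes the property monotone in [r], so it suffices to find
    a valid [r] near each [P0] of the compact set [MN N]. *)
Lemma gradient_step_uniform : exists2 beta0, 0 < beta0 &
  forall P, MN N P -> forall beta, 0 < beta -> beta <= beta0 ->
  [/\ MN N (Rt (P - beta *: T P)),
      E (Rt (P - beta *: T P)) <= E P - beta / 2 * `|T P| ^+ 2 &
      `|Rt (P - beta *: T P) - P| <= 2 * beta * `|T P|].
Proof.
apply: (@compact_uniform_radius _ _ (MN N) (fun P r => forall beta, 0 < beta -> beta <= r -> _)).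
- exact: MN_compact.
- by move=> P r s sr Pr beta b0 bs; apply: Pr => //; exact: le_trans sr.
move=> P0 NP0; have sP0 := NP0.1.
have [r1 [L [r10 L0 lip]]] := frob_gradient_locally_lipschitz E2 gE sP0.
have k0 : 0 < 4 * (n%:R ^+ 2 + 1) :> R by rewrite mulr_gt0// ltr_wpDl// exprn_ge0.
have eps0 : 0 < (4 * (n%:R ^+ 2 + 1))^-1 :> R by rewrite invr_gt0.
have [r2 r20 unif] := retraction_locally_uniform retr R2 NP0 eps0.
have [delta [C [delta0 dC]]] := retr NP0.
have n1 : 0 < n%:R + 1 :> R by rewrite ltr_wpDl.
have n0 : 0 <= n%:R :> R by [].
have n3 : 0 <= n%:R ^+ 3 :> R by exact: exprn_ge0.
have n2 : 0 <= n%:R ^+ 2 :> R by exact: exprn_ge0.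
have bb : 0 <= b ^+ 2 by exact: sqr_ge0.
(* On the ball of radius [r1] around [P0], [g] bounds the gradient; [tau] then bounds [T P] for
   projectors [P] there. *)
pose g := `|gradE P0| + L * r1.
have g0 : 0 <= g by rewrite addr_ge0// mulr_ge0// ltW.
pose tau := 2 * n%:R ^+ 2 * b ^+ 2 * g.
have tau0 : 0 <= tau by rewrite /tau mulr_ge0// mulr_ge0// mulr_ge0.
pose K := g * (2 * n%:R ^+ 3 * b ^+ 2) + L.
have K0 : 0 <= K by rewrite /K addr_ge0// mulr_ge0// mulr_ge0// mulr_ge0.
have nK0 : 0 <= 16 * n%:R ^+ 2 * K by rewrite mulr_ge0// mulr_ge0.
have step c m : 0 <= c -> 0 < m -> \forall s \near 0^'+, c * s < m.
  move=> c0 m0; have c1 : 0 < c + 1 by rewrite ltr_wpDl.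
  near=> s; have s0 : 0 < s by near: s; exact: nbhs_right_gt.
  apply: (@le_lt_trans _ _ ((c + 1) * s)); first by rewrite ler_wpM2r ?lerDl// ltW.
  by rewrite mulrC -ltr_pdivlMr//; near: s; apply: nbhs_right_lt; rewrite divr_gt0.
(* [r] bounds both the distance from [P] to [P0] and [beta]. The conditions [h1] to [h4] keep the
   step within the Lipschitz ball of the gradient, the range of the uniform retraction bound, the
   domain of the expansion at [P0], and the curvature condition. *)
near (0 : R)^'+ => r.
have r0 : 0 < r by near: r; exact: nbhs_right_gt.
have h1 : (1 + 2 * tau) * r < r1 by near: r; apply: step; rewrite // addr_ge0// mulr_ge0.
have h2 : (1 + tau) * r < r2 by near: r; apply: step; rewrite // addr_ge0.
have h3 : (n%:R * (1 + tau)) * r < delta by near: r; apply: step; rewrite // mulr_ge0// addr_ge0.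
have h4 : (16 * n%:R ^+ 2 * K) * r < 1 by near: r; apply: step.
exists r => // P NP; rewrite distrC => PP0 beta b0 br.
have sP := NP.1; have [sG _] := gE sP.
have tr0 : 0 <= tau * r by rewrite mulr_ge0// ltW.
have gP : `|gradE P| <= g.
  rewrite -(subrK (gradE P0) (gradE P)) (le_trans (ler_normD _ _))// addrC lerD2l.
  rewrite (le_trans (lip _ _ sP sP0 _ _))// ?subrr ?normr0//; first by move: PP0 h1; lra.
  by rewrite ler_wpM2l//; move: PP0 h1; lra.
have Tt : `|T P| <= tau.
  by rewrite (le_trans (PiP_norm _ NP))// ler_wpM2l// mulr_ge0// mulr_ge0.
have sT : symmx (T P) by exact: symm_PiP.
have bT : beta * `|T P| <= tau * r by rewrite mulrC ler_pM// ltW.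
have sX : symmx (- (beta *: T P)) by apply: symmxN; exact: symmxZ.
have nX : `|- (beta *: T P)| = beta * `|T P| by rewrite normrN normrZ gtr0_norm.
have NY : MN N (Rt (P - beta *: T P)).
  (* The new point is regarded as a perturbation of [P0], not of [P], since the admissible radius at
     [P] may depend on [P]. *)
  have [|+ _] := dC (P - P0 - beta *: T P) (symmxD (symmxB sP sP0) sX).
    apply: le_lt_trans (frob_le_mx_norm _) _; apply: le_lt_trans h3.
    rewrite -mulrA ler_wpM2l// mulrDl mul1r (le_trans (ler_normD _ _))//.
    by rewrite lerD// ?nX// ltW.
  by rewrite addrA [P0 + _]addrC subrK.
have Yr : `|Rt (P - beta *: T P) - P + beta *: T P| <= (4 * (n%:R ^+ 2 + 1))^-1 * (beta * `|T P|).
  have : `|Rt (P - beta *: T P) - P - PiP P (- (beta *: T P))| <=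
      (4 * (n%:R ^+ 2 + 1))^-1 * `|- (beta *: T P)|.
    by apply: unif => //; rewrite ?nX; move: PP0 bT h2; lra.
  by rewrite nX PiPN PiPZ PiP_idem ?opprK// NP.2.1.
have [] := @energy_decrease P0 P _ r1 L g beta NP NY lip L0 gP b0 _ Yr _; last by move=> *; split.
  by move: PP0 bT h1; lra.
apply: le_trans (ltW h4); rewrite -/K ler_wpM2l//.
Unshelve. all: by end_near. Qed.

(** [T a] and [T (u k)] are compared through the projection at [u k] of the gradient at [a]:
    changing the base point and changing the gradient each cost a multiple of the distance from [a]
    to [u k]. This distance is small for arbitrarily late [k], where [T (u k)] is small too. *)
Lemma PiP_gradE_limit (u : nat -> M) a : (forall k, MN N (u k)) -> MN N a ->
  cluster (u @ \oo) a -> (fun k => `|T (u k)|) @ \oo --> 0 -> T a = 0.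
Proof.
move=> Nu Na ua Tu; have sa := Na.1.
have [r [L [r0 L0 lip]]] := frob_gradient_locally_lipschitz E2 gE sa.
have n2 : 0 <= n%:R ^+ 2 :> R by exact: exprn_ge0.
have b0 : 0 <= b by rewrite addr_ge0// sqrtr_ge0.
pose C := 2 * n%:R ^+ 2 * b ^+ 2 * L + 4 * n%:R ^+ 2 * b * `|gradE a|.
have C0 : 0 <= C.
  by rewrite addr_ge0// mulr_ge0// mulr_ge0 ?sqr_ge0// mulr_ge0.
apply/eqP; rewrite -normr_le0; apply/ler_addgt0Pr => e e0; rewrite add0r.
have C1 : 0 < C + 1 by rewrite ltr_wpDl.
have [m _ mT] := (cvgr0Pnorm_lt _).1 Tu _ (divr_gt0 e0 (ltr0n _ 2)).
have d0 : 0 < Num.min r (e / 2 / (C + 1)) by rewrite lt_min r0 !divr_gt0.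
have [k mk] := (omega_limitP u a).1 ua _ d0 m.
rewrite lt_min => /andP[akr akC].
have := mT k mk; rewrite normr_id => Tk.
have base := PiP_base_norm (gradE a) Na (Nu k).
have : `|PiP (u k) (gradE a - gradE (u k))| <= 2 * n%:R ^+ 2 * b ^+ 2 * (L * `|a - u k|).
  rewrite (le_trans (PiP_norm _ (Nu k)))// ler_wpM2l ?mulr_ge0 ?sqr_ge0//.
  by apply: lip => //; [exact: (Nu k).1|rewrite subrr normr0|rewrite distrC].
rewrite PiPD PiPN -/(T (u k)) => lipk.
have Ca : C * `|a - u k| <= e / 2.
  apply: (@le_trans _ _ ((C + 1) * `|a - u k|)); first by rewrite ler_wpM2r ?lerDl.
  by rewrite mulrC -ler_pdivlMr// ltW.
have tri (x y z : M) : x = (x - y) + (y - z) + z by rewrite subrKA subrK.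
rewrite (tri (T a) (PiP (u k) (gradE a)) (T (u k))).
apply: le_trans (ler_normD _ _) _.
apply: le_trans (lerD (ler_normD _ _) (lexx _)) _.
apply: le_trans (lerD (lerD base lipk) (ltW Tk)) _.
by move: Ca; rewrite /C -/b; lra.
Qed.

(** Continuity of [E] at [a] brings the energies close to [E a] arbitrarily late; monotonicity
    extends this from those indices to all later ones. *)
Lemma energy_limit (u : nat -> M) a : (forall k, MN N (u k)) -> MN N a ->
  (forall k, E (u k.+1) <= E (u k)) ->
  cluster (u @ \oo) a -> (fun k => E (u k)) @ \oo --> E a.
Proof.
move=> Nu Na Edec ua.
have [r [L [r0 L0 lip]]] := energy_locally_lipschitz E2 Na.1.
have Emono j k : (j <= k)%N -> E (u k) <= E (u j).
  move=> /subnK <-; elim: (k - j)%N => // i IH.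
  by rewrite addSn; exact: le_trans (Edec _) IH.
have near_a e m : 0 < e -> exists2 k, (m <= k)%N & `|E a - E (u k)| <= e.
  move=> e0; have L1 : 0 < L + 1 by rewrite ltr_wpDl.
  have d0 : 0 < Num.min r (e / (L + 1)) by rewrite lt_min r0 !divr_gt0.
  have [k mk] := (omega_limitP u a).1 ua _ d0 m.
  rewrite lt_min => /andP[akr akL]; exists k => //.
  rewrite (le_trans (lip _ _ Na.1 (Nu k).1 _ _))// ?subrr ?normr0//; first by rewrite distrC.
  apply: (@le_trans _ _ ((L + 1) * `|a - u k|)); first by rewrite ler_wpM2r ?lerDl.
  by rewrite mulrC -ler_pdivlMr// ltW.
have lower k : E a <= E (u k).
  apply/ler_addgt0Pr => e e0; have [j kj] := near_a e k e0.
  by have := Emono _ _ kj; rewrite ler_norml => + /andP[_]; lra.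
apply/cvgrPdist_le => e e0; have [j _] := near_a e 0%N e0.
rewrite ler_norml => /andP[je _]; exists j => // k /= jk.
by have := lower k; have := Emono _ _ jk; rewrite ler_norml => ? ?; apply/andP; split; lra.
Qed.

End gradient_step.

(** * Distance to the critical component, and the convergence theorem *)

Lemma dist_set_omega_limit (R : realType) (n : nat) (K A : set 'M[R]_n)
    (u : nat -> 'M[R]_n) :
  compact K -> (forall k, K (u k)) -> cluster (u @ \oo) `<=` A -> A !=set0 ->
  (fun k => dist_set (u k) A) @ \oo --> 0.
Proof.
move=> cK uK cluA [a0 Aa0]; apply/cvgrPdist_le => e e0.
have n1 : 0 < n%:R + 1 :> R by rewrite ltr_wpDl.
have [m _ near_omega] := omega_limit_approx K u cK uK _ (divr_gt0 e0 n1).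
exists m => // k mk; rewrite sub0r normrN.
have [a clua ak] := near_omega k mk.
have lb : lbound [set frob (u k - Q) | Q in A] 0.
  by move=> _ [Q _ <-]; exact: frob_ge0.
rewrite ger0_norm; last by apply: lb_le_inf => //; exists (frob (u k - a0)), a0.
apply: (@le_trans _ _ (frob (u k - a))).
  by apply: ge_inf; [exists 0|exists a => //; exact: cluA].
rewrite (le_trans (frob_le_mx_norm _))// distrC.
apply: (@le_trans _ _ ((n%:R + 1) * `|a - u k|)); first by rewrite ler_wpM2r ?lerDl.
by rewrite mulrC -ler_pdivlMr// ltW.
Qed.

Lemma frob_cvg0 (R : realType) (n : nat) (u : nat -> 'M[R]_n) :
  (fun k => `|u k|) @ \oo --> 0 -> (fun k => frob (u k)) @ \oo --> 0.
Proof.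
move=> u0; have nu0 : (fun k => n%:R * `|u k|) @ \oo --> 0.
  by rewrite -(mulr0 n%:R); apply: cvgM u0; exact: cvg_cst.
apply: squeeze_cvgr (cvg_cst 0) nu0.
by near=> k; rewrite frob_ge0 frob_le_mx_norm.
Unshelve. all: by end_near. Qed.

Unset Implicit Arguments.

Theorem theorem3p1 (R : realType) (Nb N : nat) (E : 'M[R]_Nb -> R)
  (gradE : 'M[R]_Nb -> 'M[R]_Nb) (Rt : 'M[R]_Nb -> 'M[R]_Nb) :
  (1 <= N)%N -> (N <= Nb)%N ->
  C2_on_H E ->
  is_frob_gradient E gradE ->
  (forall X, symmx X -> symmx (Rt X)) ->
  C2_on_H Rt ->
  (forall P, MN N P ->
     exists delta : R, exists C : R, 0 < delta /\
       forall X, symmx X -> frob X < delta ->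
         MN N (Rt (P + X)) /\
         frob (Rt (P + X) - P - PiP P X) <= C * frob X ^+ 2) ->
  exists beta0 : R, 0 < beta0 /\
    forall beta : R, 0 < beta -> beta <= beta0 ->
    forall Pk : nat -> 'M[R]_Nb,
      MN N (Pk 0%N) ->
      (forall k, Pk k.+1 = Rt (Pk k - beta *: PiP (Pk k) (gradE (Pk k)))) ->
      (forall k, E (Pk k.+1) <= E (Pk k)) /\
      exists Ec : R,
        critical_value N E gradE Ec /\
        (fun k => E (Pk k)) @ \oo --> Ec /\
        (fun k => frob (PiP (Pk k) (gradE (Pk k)))) @ \oo --> 0 /\
        (fun k => frob (Pk k.+1 - Pk k)) @ \oo --> 0 /\
        exists Q, crit_set N E gradE Ec Q /\
          (fun k => dist_set (Pk k) (connected_component (crit_set N E gradE Ec) Q))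
            @ \oo --> 0.
Proof.
move=> _ _ E2 gE _ R2 retr.
have [beta0 beta00 stepP] := gradient_step_uniform E2 gE R2 retr.
exists beta0; split => // beta b0 bbeta0 Pk Pk0 PkS.
have NPk k : MN N (Pk k).
  by elim: k => // k IH; rewrite PkS; have [] := stepP _ IH beta b0 bbeta0.
pose T k := PiP (Pk k) (gradE (Pk k)).
have Edec k : E (Pk k.+1) <= E (Pk k) - beta / 2 * `|T k| ^+ 2.
  by rewrite PkS; have [] := stepP _ (NPk k) beta b0 bbeta0.
have dPk k : `|Pk k.+1 - Pk k| <= 2 * beta * `|T k|.
  by rewrite PkS; have [] := stepP _ (NPk k) beta b0 bbeta0.
have T2 k : 0 <= beta / 2 * `|T k| ^+ 2.
  by rewrite mulr_ge0 ?sqr_ge0// divr_ge0// ltW.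
have Emono k : E (Pk k.+1) <= E (Pk k).
  by apply: le_trans (Edec k) _; rewrite gerBl.
split => //.
have cN : compact (@MN R Nb N) by exact: MN_compact.
have clN : closed (@MN R Nb N) by apply: compact_closed => //; exact: norm_hausdorff.
pose A := cluster (Pk @ \oo).
have AN : A `<=` MN N by exact: omega_limit_sub.
(* [Q] supplies both the limit value [E Q] and the base point of the connected component. *)
have [Q AQ] : A !=set0 by apply: (omega_limit_nonempty (MN N)).
have Elim a : A a -> (fun k => E (Pk k)) @ \oo --> E a.
  by move=> Aa; apply: energy_limit NPk (AN _ Aa) Emono Aa.
have EQ := Elim Q AQ.
have Tlim : (fun k => `|T k|) @ \oo --> 0.
  apply/cvgrPdist_lt => e e0.
  (* Two consecutive energies this close to their limit differ by less than [beta / 2 * e ^+ 2], and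
     their difference dominates [beta / 2] times the squared norm of [T k]. *)
  have d0 : 0 < beta / 2 * e ^+ 2 / 2 by rewrite !(divr_gt0, mulr_gt0, exprn_gt0).
  have [m _ mE] := (cvgrPdist_lt _ _).1 EQ _ d0.
  exists m => // k mk; rewrite sub0r normrN normr_id.
  have := mE k mk; have := mE k.+1 (leqW mk); rewrite /= !ltr_norml => /andP[_ h1] /andP[h2 _].
  have h : beta / 2 * `|T k| ^+ 2 < beta / 2 * e ^+ 2 by have := Edec k; lra.
  move: h; rewrite ltr_pM2l ?divr_gt0// => h.
  by rewrite -(ltr_pXn2r (n := 2))// nnegrE// ltW.
have dlim : (fun k => `|Pk k.+1 - Pk k|) @ \oo --> 0.
  have bT : (fun k => 2 * beta * `|T k|) @ \oo --> 0.
    by rewrite -(mulr0 (2 * beta)); apply: cvgM Tlim; exact: cvg_cst.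
  apply: squeeze_cvgr (cvg_cst 0) bT.
  by near=> k; rewrite normr_ge0 dPk.
(* All omega-limit points share the value [E Q], because the whole energy sequence has a single
   limit. *)
have Acrit : A `<=` crit_set N E gradE (E Q).
  move=> a Aa; split; last exact: cvg_unique (Elim a Aa) EQ.
  split; first exact: AN.
  exact: (PiP_gradE_limit E2 gE NPk (AN a Aa) Aa Tlim).
have Aconn : connected A.
  by apply: (omega_limit_connected (MN N)) => //; apply/norm_cvg0P.
have Acomp : A `<=` connected_component (crit_set N E gradE (E Q)) Q.
  exact: connected_component_max.
exists (E Q); split; first by exists Q; split => //; exact: (Acrit Q AQ).1.
split => //; split; first exact: frob_cvg0.
split; first exact: frob_cvg0.
exists Q; split; first exact: Acrit.
by apply: (dist_set_omega_limit cN NPk Acomp); exists Q; exact: Acomp.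
Unshelve. all: by end_near. Qed.
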